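(* There exists a constant $C>0$ such that for every integer $n\ge 2$ there exists a Kakeya set $S\subset\mathbb{R}^2$ which is the union of $4n$ triangles and whose area is at most $C/\log n$.
   Context: A subset $S$ of $\mathbb{R}^2$ is called a Kakeya set if for every point $P$ on the unit circle in $\mathbb{R}^2$ there is a translate of the line segment $(0,P)$ that is contained in $S$. A triangle means a solid (two-dimensional) triangle in the plane. Area means Lebesgue measure in $\mathbb{R}^2$. *)

(* Defs.v *)
From HB Require Import structures.
From mathcomp Require Import all_boot all_order all_algebra.
From mathcomp Require Import all_classical all_reals all_analysis.

Set Implicit Arguments.
Unset Strict Implicit.
Unset Printing Implicit Defensive.

Import Order.TTheory GRing.Theory Num.Theory.
Import numFieldNormedType.Exports.

Local Open Scope classical_set_scope.
Local Open Scope ring_scope.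

(* The Euclidean unit circle; the library norm on R * R is the sup norm, hence
   the explicit equation. *)
Definition unit_circle (R : realType) : set (R * R) :=
  [set P | P.1 ^+ 2 + P.2 ^+ 2 = 1].

(* Segments are taken closed. *)
Definition segment (R : realType) (A B : R * R) : set (R * R) :=
  [set (1 - t) *: A + t *: B | t in `[0, 1]].

Definition translate (R : realType) (v : R * R) (X : set (R * R)) :
    set (R * R) :=
  [set v + x | x in X].

Definition kakeya_set (R : realType) (S : set (R * R)) : Prop :=
  forall P, unit_circle P -> exists v : R * R, translate v (segment 0 P) `<=` S.

Definition convex_hull3 (R : realType) (A B C : R * R) : set (R * R) :=
  [set x | exists a b c : R, [/\ 0 <= a, 0 <= b & 0 <= c] /\
     a + b + c = 1 /\ x = a *: A + b *: B + c *: C].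

Definition collinear (R : realType) (A B C : R * R) : Prop :=
  (B.1 - A.1) * (C.2 - A.2) = (B.2 - A.2) * (C.1 - A.1).

(* Solid (closed), nondegenerate triangles. *)
Definition is_triangle (R : realType) (X : set (R * R)) : Prop :=
  exists A B C : R * R, ~ collinear A B C /\ X = convex_hull3 A B C.

(* S is the union of k pairwise distinct triangles, which may overlap. *)
Definition union_of_triangles (R : realType) (k : nat) (S : set (R * R)) :
    Prop :=
  exists T : 'I_k -> set (R * R),
    [/\ injective T, forall i, is_triangle (T i) & S = \bigcup_i T i].

Definition area (R : realType) (S : set (R * R)) : \bar R :=
  (@lebesgue_measure R \x @lebesgue_measure R)%E S.

(* Main.v *)
(** Give the line of slope [a] in [[0, 1]] the equation
      [y = a (x - 1) + (1/k) sum_(j < k) A_j(a)],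
    where [A_j(a)] is [a] truncated to [j] binary digits. For [x] between [i/k]
    and [(i+1)/k] we have
      [y = f(A_i) + (a - A_i) (x - (i+1)/k) - (1/k) sum_(i < j < k) (a - A_j)]
    where [f] depends on the first [i] digits only, and the other terms are
    [O(2^-i / k)]: every vertical section of the union of these segments is
    covered by [2^i] intervals of length [O(2^-i / k)], hence has measure
    [O(1/k)]. Replacing the truncations of [a] by those of [m/n] for
    [m/n <= a <= (m+1)/n] makes the constant term constant on each of [n] slope
    intervals, so that the segments fill [n] triangles, at the price of a larger
    constant as long as [2^k <= n]. Four copies, obtained by symmetries of the
    square, take care of all directions. *)
Require Import Defs.
From mathcomp Require Import all_boot all_order all_algebra.
From mathcomp Require Import all_classical all_reals all_analysis.
From mathcomp Require Import measurable_realfun.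
From mathcomp Require Import ring lra zify.

Set Implicit Arguments.
Unset Strict Implicit.
Unset Printing Implicit Defensive.

Import Order.TTheory GRing.Theory Num.Theory.

Local Open Scope classical_set_scope.
Local Open Scope ring_scope.

(** * Bounding area through one-dimensional sections *)

Section Area.
Context {R : realType}.
Local Notation mu := (@lebesgue_measure R).

Lemma lebesgue_measure_le_cover (A : set R) (N : nat) (c : nat -> R) (r M : R) :
  measurable A -> 0 <= r -> N%:R * (2 * r) <= M ->
  (forall y, A y -> exists2 p, (p < N)%N & `|y - c p| <= r) ->
  (mu A <= M%:E)%E.
Proof.
move=> mA r0 NrM cov.
have muI p : mu `[c p - r, c p + r] = (2 * r)%:E.
  rewrite lebesgue_measure_itv /= lte_fin.
  case: ltP => h; first by rewrite -EFinD; congr _%:E; ring.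
  by congr _%:E; lra.
apply: (@le_trans _ _ (\sum_(p < N) mu `[(c p - r)%R, (c p + r)%R])%E).
  pose I p := `[c p - r, c p + r]%classic.
  apply: (@content_subadditive _ _ _ mu A I) => //; 
    first by move=> p _; exact: measurable_itv.
  move=> y /cov[p pN yp]; rewrite -(bigcup_mkord N I).
  exists p => //=.
  by move: yp; rewrite /I ler_distl /= in_itv.
under eq_bigr do rewrite muI.
rewrite sumEFin lee_fin sumr_const card_ord.
by rewrite (le_trans _ NrM)// [leRHS]mulr_natl.
Qed.

Lemma integral_le_unit_interval (f : R -> \bar R) (o M : R) :
  measurable_fun setT f -> (forall x, 0 <= f x)%E ->
  (forall x, f x != 0%E -> o <= x <= o + 1) ->
  (forall x, f x <= M%:E)%E ->
  (\int[mu]_x f x <= M%:E)%E.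
Proof.
move=> mf f0 fo fM.
have -> : (\int[mu]_x f x = \int[mu]_(x in `[o, (o + 1)%R]%classic) f x)%E.
  rewrite [RHS]integral_mkcond; apply: eq_integral => x _.
  rewrite patchE; case: ifPn => //; rewrite notin_setE /= in_itv /= => nx.
  by apply/eqP; apply: contra_notT nx => /fo.
apply: (@le_trans _ _ (\int[mu]_(x in `[o, (o + 1)%R]%classic) M%:E)%E).
  apply: ge0_le_integral => //; exact: measurable_funTS.
rewrite integral_cst//= lebesgue_measure_itv /= lte_fin ltrDl ltr01.
by rewrite -EFinD -EFinM lee_fin; nra.
Qed.

Lemma area_le_vertical (A : set (R * R)) (o M : R) :
  measurable A ->
  (forall z, A z -> o <= z.1 <= o + 1) ->
  (forall x, mu (xsection A x) <= M%:E)%E ->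
  (area A <= M%:E)%E.
Proof.
move=> mA Ao AM; apply: (@integral_le_unit_interval _ o) => //.
- exact: measurable_fun_xsection.
- move=> x /=; apply: contra_neqT => nx.
  rewrite (_ : xsection A x = set0) ?measure0//.
  by apply/seteqP; split => // y /xsectionP /Ao /= h; rewrite h in nx.
Qed.

Lemma area_le_horizontal (A : set (R * R)) (o M : R) :
  measurable A ->
  (forall z, A z -> o <= z.2 <= o + 1) ->
  (forall y, mu (ysection A y) <= M%:E)%E ->
  (area A <= M%:E)%E.
Proof.
move=> mA Ao AM.
(* [area] integrates the measures of vertical sections; uniqueness of the product measure exchanges
   the two coordinates. *)
have -> : area A = (mu \x^ mu)%E A.
  apply: product_measure_unique => // A1 A2 mA1 mA2.
  exact: product_measure2E.
apply: (@integral_le_unit_interval _ o) => //.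
- exact: measurable_fun_ysection.
- move=> x /=; apply: contra_neqT => nx.
  rewrite (_ : ysection A x = set0) ?measure0//.
  by apply/seteqP; split => // y /ysectionP /Ao /= h; rewrite h in nx.
Qed.

End Area.

(** * Slivers and the measure of their vertical sections *)

Section Sliver.
Context {R : realType}.
Variables (n k : nat).

(** The summands are the binary truncations of [m/n]; their mean is the height at [x = 1] shared by
    all lines with slope between [m/n] and [m.+1/n]. *)
Definition apex (m : nat) : R :=
  k%:R^-1 * \sum_(0 <= j < k) (2 ^ j * m %/ n)%:R / 2 ^+ j.

(** Since [z.1 - 1] is nonpositive, the larger slope gives the lower edge. *)
Definition sliver (m : nat) : set (R * R) :=
  [set z | 0 <= z.1 <= 1 /\
    apex m + m.+1%:R / n%:R * (z.1 - 1) <= z.2 <=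
      apex m + m%:R / n%:R * (z.1 - 1)].

Lemma sum_inv_pow2_le (i : nat) : (i < k)%N ->
  \sum_(i.+1 <= j < k) (2 ^+ j)^-1 <= (2 ^+ i)^-1 :> R.
Proof.
move=> ik.
pose g (j : nat) : R := - (2 * (2 ^+ j)^-1).
rewrite (telescope_sumr_eq g) //; last first.
  by move=> j _; rewrite /g exprS; field; rewrite expf_neq0.
rewrite /g exprS; have : 0 < (2 ^+ k : R)^-1 by rewrite invr_gt0 exprn_gt0.
have -> : 2 * (2 * 2 ^+ i)^-1 = (2 ^+ i)^-1 :> R by field; rewrite expf_neq0.
lra.
Qed.

Lemma dyadic_floor_le (j m : nat) : (0 < n)%N ->
  (2 ^ j * m %/ n)%:R / 2 ^+ j <= m%:R / n%:R :> R.
Proof.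
move=> n0; rewrite ler_pdivrMr ?exprn_gt0// mulrAC ler_pdivlMr ?ltr0n//.
by rewrite -natrX -!natrM ler_nat [(m * _)%N]mulnC leq_divM.
Qed.

(** Truncation loses at most [2^-j], and passing from [m] to [m.+1] costs [1/n], which is again at
    most [2^-j]. *)
Lemma dyadic_floor_ge (j m : nat) : (0 < n)%N -> (2 ^ j <= n)%N ->
  m.+1%:R / n%:R - 2 * (2 ^+ j)^-1 <= (2 ^ j * m %/ n)%:R / 2 ^+ j :> R.
Proof.
move=> n0 jn; rewrite ler_pdivlMr ?exprn_gt0// mulrBl -(mulrA 2).
rewrite mulVf ?expf_neq0// mulr1 lerBlDr mulrAC ler_pdivrMr ?ltr0n//.
rewrite -natrX -natrM -natrD -natrM ler_nat.
have := ltn_ceil (2 ^ j * m) n0; nia.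
Qed.

Lemma exists_subinterval (x : R) : (0 < k)%N -> 0 <= x <= 1 ->
  exists2 i, (i < k)%N & i%:R / k%:R <= x <= i.+1%:R / k%:R.
Proof.
move=> k0 /andP[x0 x1].
have kR : 0 < k%:R :> R by rewrite ltr0n.
(* At [x = 1] the integer part of [x * k] is [k], one past the last index. *)
have [->|xn1] := eqVneq x 1.
  exists k.-1; first by rewrite prednK.
  by rewrite prednK// divff ?gt_eqF// lexx ler_pdivrMr// mul1r ler_nat leq_pred.
have /truncn_itv/andP[h1 h2] : 0 <= x * k%:R by rewrite mulr_ge0.
exists (Num.trunc (x * k%:R)); last first.
  by rewrite ler_pdivrMr// ler_pdivlMr// h1 ltW.
rewrite -(ltr_nat R); apply: le_lt_trans h1 _.
by rewrite gtr_pMl// lt_neqAle xn1.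
Qed.

(* On the strip [i/k <= x <= (i+1)/k] the [i] leading binary digits of the slope
   [m/n] determine the height of the sliver up to [4 * 2^-i / k], since the
   coefficient of the tail of the slope is [x - (i+1)/k]. *)
Lemma sliver_fiber_cover (x : R) : (0 < k)%N -> (2 ^ k <= n)%N -> 0 <= x <= 1 ->
  exists N (c : nat -> R) r, [/\ 0 <= r, N%:R * (2 * r) <= 4 / k%:R &
    forall m y, (m < n)%N -> sliver m (x, y) ->
      exists2 p, (p < N)%N & `|y - c p| <= r].
Proof.
move=> k0 kn x01.
have n0 : (0 < n)%N by apply: leq_trans kn; rewrite expn_gt0.
have jn j : (j <= k)%N -> (2 ^ j <= n)%N.
  by move=> jk; apply: leq_trans kn; rewrite leq_exp2l.
have [i ik xi] := exists_subinterval k0 x01.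
have kR : 0 < k%:R :> R by rewrite ltr0n.
pose e : R := (2 ^+ i)^-1.
have e0 : 0 < e by rewrite invr_gt0 exprn_gt0.
(* Height at [x] of the line attached to slope [p / 2^i]: its truncations to more than [i] digits
   all equal [p / 2^i], and these [k - i - 1] terms are merged with the slope term. *)
pose head (p : nat) : R :=
  k%:R^-1 * (\sum_(0 <= j < i.+1) (p %/ 2 ^ (i - j))%:R / 2 ^+ j) +
  p%:R / 2 ^+ i * (x - i.+1%:R / k%:R).
(* The heights will lie between [head p - 4 * e / k] and [head p]. One [2 * e / k] comes from the
   tail of the truncations, the other from a slope error [2 * e] over a width at most [1/k]. *)
exists (2 ^ i)%N, (fun p => head p - 2 * e / k%:R), (2 * e / k%:R); split.
- by rewrite divr_ge0 ?mulr_ge0// ltW.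
- rewrite natrX /e le_eqVlt; apply/orP; left; apply/eqP; field.
  by rewrite gt_eqF// expf_neq0.
move=> m y mn [_ /= /andP[ylo yhi]].
pose A j : R := (2 ^ j * m %/ n)%:R / 2 ^+ j.
(* The first [i] binary digits of [m/n]; all shorter truncations are prefixes of these. *)
exists (2 ^ i * m %/ n)%N.
  by rewrite ltn_divLR// ltn_pmul2l// expn_gt0.
have Ahead : \sum_(0 <= j < i.+1) A j =
    \sum_(0 <= j < i.+1) ((2 ^ i * m %/ n) %/ 2 ^ (i - j))%:R / 2 ^+ j.
  apply: eq_big_nat => j /andP[_ ji]; congr (_%:R / _).
  rewrite -divnMA (_ : 2 ^ i * m = 2 ^ j * m * 2 ^ (i - j))%N.
    by rewrite divnMr// expn_gt0.
  by rewrite mulnAC -expnD subnKC.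
pose T := \sum_(i.+1 <= j < k) A j.
have apexE : apex m = k%:R^-1 * (\sum_(0 <= j < i.+1) A j + T).
  by rewrite /apex (big_cat_nat _ (n := i.+1)).
have Thi : T <= (k - i.+1)%:R * (m%:R / n%:R).
  rewrite mulr_natl -sumr_const_nat; apply: ler_sum => j _.
  exact: dyadic_floor_le.
have Tlo : (k - i.+1)%:R * (m.+1%:R / n%:R) - 2 * e <= T.
  apply: (@le_trans _ _ (\sum_(i.+1 <= j < k)
      (m.+1%:R / n%:R - 2 * (2 ^+ j)^-1))).
    rewrite sumrB sumr_const_nat -[X in _ <= X - _]mulr_natl lerD2l.
    by rewrite lerN2 -mulr_sumr ler_pM2l// sum_inv_pow2_le.
  apply: ler_sum_nat => j /andP[_ jk]; apply: dyadic_floor_ge => //.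
  by apply: jn; exact: ltnW.
have Ai_lo := dyadic_floor_le i m n0.
have Ai_hi := dyadic_floor_ge m n0 (jn _ (ltnW ik)).
rewrite /head -Ahead; rewrite apexE in ylo yhi.
rewrite -/(A i) in Ai_lo Ai_hi *; rewrite -/e in Ai_hi.
set B := \sum_(0 <= j < i.+1) A j in ylo yhi *.
move: xi => /andP[xi1 xi2].
rewrite -natr1 mulrDl mul1r in xi2 *.
have kiE : (k - i.+1)%:R = k%:R - i%:R - 1 :> R by rewrite natrB// -natr1; ring.
rewrite kiE in Thi Tlo.
set s := m%:R / n%:R in yhi Thi Ai_lo *.
set s' := m.+1%:R / n%:R in ylo Tlo Ai_hi *.
set K := (k%:R : R) in kR *.
set I := (i%:R : R) in xi1 xi2 Thi Tlo *.
have iK : 0 < K^-1 by rewrite invr_gt0.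
have KK : K^-1 * K = 1 by rewrite mulVf// gt_eqF.
have hThi : K^-1 * T <= K^-1 * ((K - I - 1) * s) by rewrite ler_pM2l.
have hTlo : K^-1 * ((K - I - 1) * s' - 2 * e) <= K^-1 * T by rewrite ler_pM2l.
(* The tail of the apex moves the pivot of the line from [x = 1] to the right end of the strip,
   where the slope has a coefficient in [[-1/k, 0]]. *)
have E1 t : K^-1 * ((K - I - 1) * t) + t * (x - 1) = t * (x - (I / K + K^-1)).
  by field; rewrite gt_eqF.
have d0 : x - (I / K + K^-1) <= 0 by lra.
have d1 : - K^-1 <= x - (I / K + K^-1) by lra.
have P1 : s * (x - (I / K + K^-1)) <= A i * (x - (I / K + K^-1)).
  by apply: ler_wnM2r.
have P2 : (A i + 2 * e) * (x - (I / K + K^-1)) <= s' * (x - (I / K + K^-1)).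
  by apply: ler_wnM2r => //; lra.
have P3 : 2 * e * - K^-1 <= 2 * e * (x - (I / K + K^-1)).
  by rewrite ler_pM2l// mulr_gt0.
have := E1 s; have := E1 s'.
rewrite ler_distl; set d := x - _ in P1 P2 P3 d0 d1 *; lra.
Qed.

End Sliver.

(** * Slivers as distinct, nondegenerate, measurable triangles *)

Section SliverShape.
Context {R : realType}.
Variables (n k : nat).
Hypothesis n0 : (0 < n)%N.

Lemma apex_ge0_le1 (m : nat) : (0 < k)%N -> (m < n)%N ->
  0 <= (apex n k m : R) <= 1.
Proof.
move=> k0 mn; have kR : 0 < k%:R :> R by rewrite ltr0n.
rewrite /apex; apply/andP; split.
  rewrite mulr_ge0// sumr_ge0// => j _; rewrite divr_ge0// exprn_ge0//.
rewrite mulrC ler_pdivrMr// mul1r.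
apply: (@le_trans _ _ (\sum_(0 <= j < k) (1 : R))).
  apply: ler_sum => j _; apply: le_trans (dyadic_floor_le j m n0) _.
  by rewrite ler_pdivrMr ?ltr0n// mul1r ler_nat ltnW.
by rewrite sumr_const_nat subn0.
Qed.

Lemma sliver_apex (m : nat) : sliver n k m (1 : R, apex n k m).
Proof. by split => /=; rewrite ?ler01 ?lexx// subrr !mulr0 addr0 lexx. Qed.

(** The section at [x = 1] is the apex alone; once the apexes agree, the top of the section at
    [x = 0] determines the slope. *)
Lemma sliver_inj (m m' : nat) :
  sliver n k m = sliver n k m' :> set (R * R) -> m = m'.
Proof.
have half a b : sliver n k a = sliver n k b :> set (R * R) -> (b <= a)%N.
  move=> ab.
  have := sliver_apex a; rewrite {1}ab => -[/= _].
  rewrite subrr !mulr0 !addr0 => /le_anti aE.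
  have : sliver n k a (0 : R, apex n k a - a%:R / n%:R).
    split => /=; first by rewrite lexx ler01.
    rewrite sub0r !mulrN1 lexx andbT lerD2l lerN2.
    by rewrite ler_pM2r ?invr_gt0 ?ltr0n// ler_nat.
  rewrite ab => -[/= _ /andP[_]]; rewrite aE sub0r mulrN1 lerD2l lerN2.
  by rewrite ler_pM2r ?invr_gt0 ?ltr0n// ler_nat.
by move=> E; apply/eqP; rewrite eqn_leq !half.
Qed.

Lemma sliver_bound (m : nat) (z : R * R) : (0 < k)%N -> (m < n)%N ->
  sliver n k m z -> 0 <= z.1 <= 1 /\ -1 <= z.2 <= 1.
Proof.
move=> k0 mn [/andP[z0 z1] /andP[lo hi]]; split; first by rewrite z0.
have /andP[h0 h1] := apex_ge0_le1 k0 mn.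
have m0 : 0 <= m%:R / n%:R :> R by rewrite divr_ge0.
have m1 : m.+1%:R / n%:R <= 1 :> R.
  by rewrite ler_pdivrMr ?ltr0n// mul1r ler_nat.
have m2 : 0 <= m.+1%:R / n%:R :> R by rewrite divr_ge0.
by apply/andP; split; nra.
Qed.

Lemma sliver_hull (m : nat) :
  sliver n k m = convex_hull3 (1 : R, apex n k m) (0, apex n k m - m%:R / n%:R)
    (0, apex n k m - m.+1%:R / n%:R).
Proof.
have nR : 0 < n%:R :> R by rewrite ltr0n.
have ni : 0 < n%:R^-1 :> R by rewrite invr_gt0.
have mE : m.+1%:R / n%:R = m%:R / n%:R + n%:R^-1 :> R.
  by rewrite -natr1 mulrDl mul1r.
apply/seteqP; split => [[x y]|z] /=.
  rewrite /sliver /= mE; set s := m%:R / _; set h := apex n k m.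
  move=> [/andP[x0 x1] /andP[lo hi]].
  have nn : n%:R * n%:R^-1 = 1 :> R by rewrite divff// gt_eqF.
  (* Barycentric weight of the lowest vertex: [c / n] is the drop of [y] below the upper edge. *)
  pose c := n%:R * (h - (1 - x) * s - y).
  have cE : c * n%:R^-1 = h - (1 - x) * s - y by rewrite /c mulrAC nn mul1r.
  exists x, (1 - x - c), c; split; [split|split].
  - exact: x0.
  - by rewrite -(pmulr_lge0 _ ni) mulrBl cE; nra.
  - by apply: mulr_ge0; [exact: ltW|lra].
  - by ring.
  - congr pair; rewrite /= /GRing.scale /=; first by ring.
    rewrite (_ : x * h + _ + _ = h - (1 - x) * s - c * n%:R^-1).
      by rewrite cE; ring.
    by ring.
move=> [a [b [c [[a0 b0 c0] [abc ->]]]]]; rewrite /sliver /= /GRing.scale /= mE.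
set s := m%:R / _; set h := apex n k m; set t := n%:R^-1 in ni *.
have b1 : a = 1 - b - c by lra.
have cn := mulr_ge0 c0 (ltW ni); have bn := mulr_ge0 b0 (ltW ni).
split; apply/andP; split; rewrite ?b1; nra.
Qed.

Lemma sliver_not_collinear (m : nat) :
  ~ collinear (1 : R, apex n k m) (0, apex n k m - m%:R / n%:R)
    (0, apex n k m - m.+1%:R / n%:R).
Proof.
have ni : 0 < n%:R^-1 :> R by rewrite invr_gt0 ltr0n.
rewrite /collinear /= -natr1 => h; nra.
Qed.

Lemma measurable_sliver (m : nat) : measurable (sliver n k m : set (R * R)).
Proof.
have m1 : measurable_fun setT (fst : R * R -> R) by exact: measurable_fst.
have m2 : measurable_fun setT (snd : R * R -> R) by exact: measurable_snd.
have ml (c d : R) : measurable_fun setT (fun z : R * R => c + d * (z.1 - 1)).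
  apply: measurable_funD => //; apply: measurable_funM => //.
  exact: measurable_funB.
rewrite (_ : sliver n k m = ((setT `&` [set z | 0 <= z.1]) `&`
    (setT `&` [set z | z.1 <= 1])) `&`
   ((setT `&` [set z | apex n k m + m.+1%:R / n%:R * (z.1 - 1) <= z.2]) `&`
    (setT `&` [set z | z.2 <= apex n k m + m%:R / n%:R * (z.1 - 1)])));
  last first.
  rewrite !setTI; apply/seteqP; split => z /=.
    by move=> [/andP[? ?] /andP[? ?]].
  by move=> [[z0 z1] [z2 z3]]; split; apply/andP.
by apply: measurableI; apply: measurableI; apply: measurable_fun_le.
Qed.

End SliverShape.

(** * Isometric copies: coordinate swap, reflection, horizontal shift *)

Section Copies.
Context {R : realType}.
Variables (s e : bool) (o : R).

Definition place (z : R * R) : R * R :=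
  if s then (o + (-1) ^+ e * z.2, z.1) else (o + z.1, (-1) ^+ e * z.2).

(** Inverse of [place]. Copies are taken as preimages under it, so that measurability and membership
    transfer directly. *)
Definition pull (z : R * R) : R * R :=
  if s then (z.2, (-1) ^+ e * (z.1 - o)) else (z.1 - o, (-1) ^+ e * z.2).

Lemma placeK : cancel place pull.
Proof.
by move=> [x y]; rewrite /pull /place; case: s => /=; congr pair;
  rewrite ?(addrC o) ?addrK ?signrMK.
Qed.

Lemma pullK : cancel pull place.
Proof.
by move=> [x y]; rewrite /pull /place; case: s => /=; congr pair;
  rewrite ?signrMK ?(addrC o) ?subrK.
Qed.

Lemma preimage_pull_inj (X Y : set (R * R)) :
  pull @^-1` X = pull @^-1` Y -> X = Y.
Proof.
by move=> XY; apply/seteqP; split => z; rewrite -{1}(placeK z) => Xz;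
  rewrite -(placeK z); [change ((pull @^-1` Y) (place z)); rewrite -XY
                       |change ((pull @^-1` X) (place z)); rewrite XY].
Qed.

Lemma place_affine (A B C : R * R) (a b c : R) : a + b + c = 1 ->
  place (a *: A + b *: B + c *: C) = a *: place A + b *: place B + c *: place C.
Proof.
move=> abc; have a1 : a = 1 - b - c by lra.
rewrite /place; case: s; congr pair; rewrite /= /GRing.scale /= a1; ring.
Qed.

Lemma preimage_pull_hull (A B C : R * R) :
  pull @^-1` convex_hull3 A B C = convex_hull3 (place A) (place B) (place C).
Proof.
apply/seteqP; split => z /= [a [b [c [abc0 [abc1 zE]]]]]; exists a, b, c.
  by split=> //; split=> //; rewrite -place_affine// -zE pullK.
by split=> //; split=> //; rewrite zE -place_affine// placeK.
Qed.

Lemma place_collinear (A B C : R * R) :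
  collinear (place A) (place B) (place C) -> collinear A B C.
Proof.
rewrite /collinear /place; case: s; case: e => /=; rewrite ?expr0 ?expr1; lra.
Qed.

Lemma measurable_pull : measurable_fun setT pull.
Proof.
have m1 : measurable_fun setT (fst : R * R -> R) by exact: measurable_fst.
have m2 : measurable_fun setT (snd : R * R -> R) by exact: measurable_snd.
rewrite /pull; case: s.
- apply: measurable_fun_pair => //; apply: measurable_funM => //.
  exact: measurable_funB.
- apply: measurable_fun_pair; first exact: measurable_funB.
  exact: measurable_funM.
Qed.

End Copies.

(** * The union of the slivers: its area and its directions *)

Section Fan.
Context {R : realType}.
Variables (n k : nat).
Hypotheses (k0 : (0 < k)%N) (kn : (2 ^ k <= n)%N).

Definition fan : set (R * R) := \bigcup_(m in `I_n) sliver n k m.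

Lemma measurable_fan : measurable fan.
Proof. by apply: bigcup_measurable => m _; exact: measurable_sliver. Qed.

Lemma fan_fst (z : R * R) : fan z -> 0 <= z.1 <= 1.
Proof. by move=> [m _ []]. Qed.

(** The change of variable [e * (y - o)] preserves lengths, so one bound serves both the vertical
    sections of unswapped copies and the horizontal sections of swapped ones. *)
Lemma fan_fiber_le (B : set R) (x e o : R) : measurable B -> `|e| = 1 ->
  (forall y, B y -> fan (x, e * (y - o))) ->
  (lebesgue_measure B <= (4 / k%:R)%:E)%E.
Proof.
move=> mB e1 Bfan.
have [x01|x01] := boolP (0 <= x <= 1); last first.
  apply: (@lebesgue_measure_le_cover _ B 0 (fun=> 0) 0) => //.
  - by rewrite mul0r divr_ge0.
  - by move=> y /Bfan /fan_fst /= h; rewrite h in x01.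
have [N [c [r [r0 Nr cov]]]] := @sliver_fiber_cover R n k x k0 kn x01.
apply: (@lebesgue_measure_le_cover _ B N (fun p => o + e^-1 * c p) r) => //.
move=> y /Bfan[m mn /(cov _ _ mn)[p pN yp]]; exists p => //.
have e0 : e != 0 by rewrite -normr_eq0 e1 oner_eq0.
rewrite -(mul1r `|_|) -e1 -normrM mulrBr mulrDr mulVKf//.
by rewrite opprD addrA -mulrBr.
Qed.

Lemma area_fan_copy (s e : bool) (o : R) :
  (area (pull s e o @^-1` fan) <= (4 / k%:R)%:E)%E.
Proof.
have mF : measurable (pull s e o @^-1` fan).
  by rewrite -[X in measurable X]setTI; apply: measurable_pull => //;
     exact: measurable_fan.
have e1 : `|(-1) ^+ e| = 1 :> R by rewrite normr_sign.
case: s mF => mF.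
- apply: (@area_le_horizontal _ _ 0) => //.
    by move=> z /fan_fst; rewrite /pull /= add0r.
  move=> y; apply: (@fan_fiber_le _ y ((-1) ^+ e) o) => //.
    exact: measurable_ysection.
  by move=> x /ysectionP.
- apply: (@area_le_vertical _ _ o) => //.
    move=> z /fan_fst /=; lra.
  move=> x; apply: (@fan_fiber_le _ (x - o) ((-1) ^+ e) 0) => //.
    exact: measurable_xsection.
  by move=> y /xsectionP; rewrite subr0.
Qed.

(** The line of slope [a] through the apex stays in the sliver whose slope interval contains [a]. *)
Lemma fan_direction (a u : R) : 0 <= a <= 1 -> -1 <= u <= 1 ->
  exists2 m, (m < n)%N & exists z : R * R, forall t, 0 <= t <= 1 ->
    sliver n k m (z.1 + t * u, z.2 + t * (a * u)).
Proof.
move=> a01 /andP[u0 u1].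
have n0 : (0 < n)%N by apply: leq_trans kn; rewrite expn_gt0.
have [m mn /andP[ma am]] := exists_subinterval n0 a01.
exists m => //.
(* Start at the left end if [u] is nonnegative, otherwise far enough right to end at [0]. *)
pose x0 := Num.max 0 (- u).
exists (x0, apex n k m + a * (x0 - 1)) => t' /andP[t0 t1] /=.
have x01 : 0 <= x0 + t' * u <= 1.
  by rewrite /x0; case: (leP 0 (- u)) => h; apply/andP; split; nra.
split => //=; move: x01 => /andP[x0' x1'].
by apply/andP; split; nra.
Qed.

End Fan.

(** * Four copies covering all directions *)

Section Pieces.
Context {R : realType}.
Variables (n k : nat).
Hypotheses (k0 : (0 < k)%N) (kn : (2 ^ k <= n)%N).

Let n0 : (0 < n)%N.
Proof. by apply: leq_trans kn; rewrite expn_gt0. Qed.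

(* The four copies, indexed by [q < 4], are pushed 3 apart so that triangles of
   different copies are distinct. *)
Definition chart (q : nat) : R * R -> R * R :=
  pull (1 < q)%N (odd q) (3 * q)%:R.

Definition piece (i : nat) : set (R * R) :=
  chart (i %/ n) @^-1` sliver n k (i %% n).

Lemma piece_triangle (i : nat) : is_triangle (piece i).
Proof.
rewrite /piece sliver_hull// preimage_pull_hull.
eexists _, _, _; split; last by reflexivity.
by move=> /place_collinear; exact: sliver_not_collinear.
Qed.

Lemma piece_fst (i : nat) (z : R * R) : piece i z ->
  (3 * (i %/ n))%:R - 1 <= z.1 <= (3 * (i %/ n))%:R + 1.
Proof.
have im : (i %% n < n)%N by rewrite ltn_mod.
move=> /(sliver_bound n0 k0 im); rewrite /chart /pull.
by case: ifP => _; case: odd => /= -[/andP[? ?] /andP[? ?]];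
   apply/andP; split; lra.
Qed.

(** Copy [q] lies within horizontal distance 1 of [3 * q], so a common point identifies the copy;
    [sliver_inj] then identifies the sliver. *)
Lemma piece_inj : injective piece.
Proof.
move=> i j ij.
have [z iz] : exists z, piece i z.
  exists (place (1 < i %/ n)%N (odd (i %/ n)) (3 * (i %/ n))%:R
    (1, apex n k (i %% n))).
  by rewrite /piece /chart /= placeK; exact: sliver_apex.
have /andP[i1 i2] := piece_fst iz.
rewrite ij in iz; have /andP[j1 j2] := piece_fst iz.
have qij : (i %/ n = j %/ n)%N.
  have : (3 * (i %/ n))%:R <= (3 * (j %/ n) + 2)%:R :> R by rewrite natrD; lra.
  have : (3 * (j %/ n))%:R <= (3 * (i %/ n) + 2)%:R :> R by rewrite natrD; lra.
  by rewrite !ler_nat; lia.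
move: ij; rewrite /piece qij => /preimage_pull_inj /(sliver_inj n0) rij.
by rewrite (divn_eq i n) (divn_eq j n) qij rij.
Qed.

Lemma piece_cover (q m : nat) : (q < 4)%N -> (m < n)%N ->
  exists i : 'I_(4 * n), piece i = chart q @^-1` sliver n k m.
Proof.
move=> q4 mn; have i4 : (q * n + m < 4 * n)%N by nia.
exists (Ordinal i4) => /=.
by rewrite /piece divnMDl// divn_small// addn0 modnMDl modn_small.
Qed.

Lemma area_pieces :
  (area (\bigcup_(i : 'I_(4 * n)) piece i) <= (16 / k%:R)%:E)%E.
Proof.
have mp i : measurable (piece i).
  rewrite -[X in measurable X]setTI; apply: measurable_pull => //.
  exact: measurable_sliver.
have mf q : measurable (chart q @^-1` fan n k).
  rewrite -[X in measurable X]setTI; apply: measurable_pull => //.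
  exact: measurable_fan.
have mS : measurable (\bigcup_(i : 'I_(4 * n)) piece i).
  by apply: fin_bigcup_measurable => //; exact: finite_finset.
apply: (@le_trans _ _ (\sum_(q < 4) area (chart q @^-1` @fan R n k))%E).
  apply: (@content_subadditive _ _ _ (lebesgue_measure \x lebesgue_measure)%E _
    (fun q => chart q @^-1` fan n k)) => //; first by move=> q _; exact: mf.
  move=> z [i _ iz].
  rewrite -(bigcup_mkord 4 (fun q => chart q @^-1` fan n k)).
  exists (i %/ n)%N => /=; first by rewrite ltn_divLR.
  by exists (i %% n)%N => //=; rewrite ltn_mod.
apply: (@le_trans _ _ (\sum_(q < 4) (4 / k%:R)%:E)%E).
  by apply: lee_sum => q _; exact: area_fan_copy.
rewrite sumEFin lee_fin sumr_const card_ord; lra.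
Qed.

(** Swapping makes [u] the coordinate of larger absolute value, and reflecting makes the slope
    [w / u] nonnegative; this brings every direction to a slope in [[0, 1]]. *)
Lemma kakeya_pieces : kakeya_set (\bigcup_(i : 'I_(4 * n)) piece i).
Proof.
move=> [P1 P2]; rewrite /unit_circle /= => P11.
pose s := `|P1| < `|P2|.
pose u := if s then P2 else P1; pose w := if s then P1 else P2.
have uw : u ^+ 2 + w ^+ 2 = 1 by rewrite /u /w; case: (s); lra.
have wu : `|w| <= `|u|.
  by rewrite /u /w /s; case: ltP => // /ltW.
have u0 : u != 0.
  apply: contraTneq wu => u0; move: uw; rewrite u0 normr0 expr0n add0r.
  move=> w1; rewrite normr_le0; apply: contra_eq_neq w1 => ->.
  by rewrite expr0n eq_sym oner_eq0.
have u1 : -1 <= u <= 1 by apply/andP; split; nra.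
pose e := w / u < 0.
pose a := (-1) ^+ e * (w / u).
have a01 : 0 <= a <= 1.
  have -> : a = `|w / u|.
    by rewrite /a /e [in RHS]real_normrEsign ?num_real.
  by rewrite normr_ge0 normf_div ler_pdivrMr ?normr_gt0// mul1r.
have [m mn [z zt]] := fan_direction kn a01 u1.
pose q := (2 * s + e)%N.
have q4 : (q < 4)%N by rewrite /q; case: (s); case: (e).
have qs : (1 < q)%N = s by rewrite /q; case: (s); case: (e).
have qe : odd q = e by rewrite /q; case: (s); case: (e).
have [i iE] := piece_cover q4 mn.
exists (place s e (3 * q)%:R z) => _ [_ [t t01 <-] <-].
exists i => //; rewrite iE /chart qs qe.
move: t01; rewrite /= in_itv /= => /zt.
congr (sliver _ _ _ _).
rewrite -[LHS](placeK s e (3 * q)%:R); congr (pull _ _ _ _).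
(* Undoing the reflection turns the direction [(u, a * u)] into [(u, w)]. *)
have aw : (-1) ^+ e * (a * u) = w by rewrite /a mulrA signrMK divfK.
rewrite /place; move: aw; rewrite /u /w; case: (s) => aw; congr pair => /=;
  rewrite /GRing.scale /= ?mulr0 ?add0r //.
- by rewrite mulrDr (mulrCA _ t) aw addrA.
- by rewrite addrA.
- by rewrite mulrDr (mulrCA _ t) aw.
Qed.

End Pieces.

(** * The logarithmic bound and the conclusion *)

Lemma ln_le_trunc_log (R : realType) (n : nat) : (0 < n)%N ->
  ln n%:R <= (trunc_log 2 n).+1%:R :> R.
Proof.
move=> n0; have /andP[_ nk] := trunc_log_bounds (ltnSn 1) n0.
apply: (@le_trans _ _ (ln (2 ^+ (trunc_log 2 n).+1))).
  by rewrite ler_ln ?posrE ?ltr0n ?exprn_gt0// -natrX ler_nat ltnW.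
rewrite lnXn// -[leRHS]mulr1 mulr_natl lerMn2r /=.
(* The bound needed is [ln 2 <= 1]. *)
by apply: (@le_ln1Dx R 1); lra.
Qed.

Theorem theorem1p4 (R : realType) :
  exists C : R, 0 < C /\
    forall n : nat, (2 <= n)%N ->
      exists S : set (R * R),
        [/\ kakeya_set S,
            union_of_triangles (4 * n)%N S
          & (area S <= (C / ln n%:R)%:E)%E].
Proof.
(* The area is at most [16 / k], and [ln n <= k + 1 <= 2 * k]. *)
exists 32; split=> // n n2.
have n0 : (0 < n)%N by exact: ltnW.
pose k := trunc_log 2 n.
have k0 : (0 < k)%N by rewrite trunc_log_gt0.
have /andP[kn _] := trunc_log_bounds (ltnSn 1) n0; rewrite -/k in kn.
exists (\bigcup_(i : 'I_(4 * n)) piece n k i); split.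
- exact: kakeya_pieces.
- exists (fun i : 'I_(4 * n) => piece n k i); split => //.
    by move=> i j /(piece_inj k0 kn) /val_inj.
  by move=> i; exact: piece_triangle.
- apply: le_trans (area_pieces k0 kn) _; rewrite lee_fin.
  have lnn : ln n%:R <= k.+1%:R :> R := ln_le_trunc_log R n0.
  have ln0 : 0 < ln n%:R :> R by rewrite ln_gt0// ltr1n.
  have k1 : 1 <= k%:R :> R by rewrite ler1n.
  rewrite ler_pdivrMr ?ltr0n// mulrAC ler_pdivlMr//.
  by move: lnn; rewrite -natr1; lra.
Qed.
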